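(* Let $n\ge 2$ and let $\mathcal{E}=\{e_1,\dots,e_{n+1}\}$ be a basis of $\mathbb{R}^{n+1}$. Then the set $F(\mathcal{E})\subset\mathbb{R}\mathrm{P}^n$ has $\mu$-measure zero.
   Context: For a nonzero vector $v\in\mathbb{R}^{n+1}$, $[v]\in\mathbb{R}\mathrm{P}^n$ denotes its direction. For an ordered basis $\mathcal{E}=\{e_1,\dots,e_{n+1}\}$ of $\mathbb{R}^{n+1}$ and $j\in\{1,\dots,n+1\}$, $\mathcal{E}_j=\{e^j_1,\dots,e^j_{n+1}\}$ is the basis with $e^j_j=e_j$ and $e^j_i=e_i+e_j$ for $i\ne j$. For a multi-index $I=i_1i_2\cdots i_k$ with entries in $\{1,\dots,n+1\}$, $|I|=k$, define recursively $\mathcal{E}_{\emptyset}=\mathcal{E}$ and $\mathcal{E}_{i_1\cdots i_k}=(\mathcal{E}_{i_1\cdots i_{k-1}})_{i_k}$. $S(\mathcal{E})=\{[\sum_{i} t_ie_i] : t_i\ge 0 \text{ not all } 0\}$ is the closed projective $n$-simplex with vertices $[e_1],\dots,[e_{n+1}]$ that contains $[e_1+\dots+e_{n+1}]$. Put $F_k=\bigcup_{|I|=k}S(\mathcal{E}_I)$ (so $F_0=S(\mathcal{E})$) and $F(\mathcal{E})=\bigcap_{k\in\mathbb{N}}F_k$. $\mu$ is any measure induced on $\mathbb{R}\mathrm{P}^n$ by the Lebesgue measure of an affine chart (affine $n$-plane), or, equivalently as far as null sets are concerned, the measure induced on $\mathbb{R}\mathrm{P}^n$ by the canonical measure of the sphere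 $\mathbb{S}^n$. *)

(* Defs.v *)
From HB Require Import structures.
From mathcomp Require Import all_boot all_order all_algebra.
From mathcomp Require Import all_classical all_reals all_analysis.
From mathcomp Require Import measurable_realfun.

Set Implicit Arguments.
Unset Strict Implicit.
Unset Printing Implicit Defensive.
Import Order.TTheory GRing.Theory Num.Theory.
Import numFieldNormedType.Exports.

Local Open Scope classical_set_scope.
Local Open Scope ring_scope.

Section pushforward_mfun.
Context d1 d2 (T1 : measurableType d1) (T2 : measurableType d2) (R : realType).
Variables (mu : {measure set T1 -> \bar R}) (f : {mfun T1 >-> T2}).

(* The library only makes [pushforward mu f] a measure in the presence of a
   separate proof that [f] is measurable; here that proof is bundled in [f]. *)
Definition mpushforward : set T2 -> \bar R := pushforward mu f.

Let mpushforward0 : mpushforward set0 = 0%E.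
Proof. by rewrite /mpushforward /pushforward preimage_set0 measure0. Qed.

Let mpushforward_ge0 A : (0 <= mpushforward A)%E.
Proof. by rewrite /mpushforward /pushforward; exact: measure_ge0. Qed.

Let mpushforward_sigma_additive : semi_sigma_additive mpushforward.
Proof.
have mf : measurable_fun setT f by exact: measurable_funPT.
move=> F mF tF mUF; rewrite /mpushforward /pushforward preimage_bigcup.
apply: measure_semi_sigma_additive.
- by move=> n; rewrite -[X in measurable X]setTI; exact: mf.
- apply/trivIsetP => /= i j _ _ ij; rewrite -preimage_setI.
  by move/trivIsetP : tF => /(_ _ _ _ _ ij) ->//; rewrite preimage_set0.
- by rewrite -preimage_bigcup -[X in measurable X]setTI; exact: mf.
Qed.

HB.instance Definition _ := isMeasure.Build _ _ _ mpushforward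
  mpushforward0 mpushforward_ge0 mpushforward_sigma_additive.

End pushforward_mfun.

(* R^n as a measurable space: the library's sigma-algebra on [n.-tuple] is
   generated by the coordinates, so its measurable sets are the Borel sets. *)
Notation tupleR R n := (n.-tuple (measurableTypeR R)).

(* The library has Lebesgue measure on R and products of two measures, but no
   Lebesgue measure on R^n: it is obtained here by iterating the product along
   R * R^n ~ R^(n+1). *)
Section lebesgue_step.
Context {R : realType} (n : nat).
Local Notation RRn := ((measurableTypeR R * tupleR R n)%type).

Definition cons_tupleR (x : RRn) : tupleR R n.+1 := [tuple of x.1 :: x.2].

Lemma measurable_cons_tupleR : measurable_fun setT cons_tupleR.
Proof. exact: measurable_cons. Qed.

HB.instance Definition _ :=
  isMeasurableFun.Build _ _ _ _ cons_tupleR measurable_cons_tupleR.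

Variable mu : {sigma_finite_measure set (tupleR R n) -> \bar R}.

Definition lebesgue_cons : set (tupleR R n.+1) -> \bar R :=
  mpushforward ((@lebesgue_measure R) \x mu)%E cons_tupleR.

HB.instance Definition _ := Measure.on lebesgue_cons.

Lemma sigma_finite_lebesgue_cons : sigma_finite setT lebesgue_cons.
Proof.
have /sigma_finiteP[F [TF ndF Foo]] := sigma_finiteT (@lebesgue_measure R).
have /sigma_finiteP[G [TG ndG Goo]] := sigma_finiteT mu.
pose g (t : tupleR R n.+1) : RRn := (thead t, [tuple of behead t]).
have mg : measurable_fun setT g.
  apply/measurable_fun_pairP; split; first exact: measurable_tnth.
  exact: measurable_behead.
have gK x : g (cons_tupleR x) = x.
  by case: x => x t; rewrite /g theadE; congr pair; apply/val_inj.
exists (fun k => g @^-1` (F k `*` G k)).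
  rewrite -preimage_bigcup (_ : \bigcup_k _ = setT) ?preimage_setT//.
  rewrite -setXTT TF TG predeqE => -[x y]; split.
    by move=> [k _ []/= ? ?]; split; exists k.
  move=> [/= [i _ Fix_] [j _ Gjy]]; exists (maxn i j) => //; split.
  - by move: x Fix_; exact/subsetPset/ndF/leq_maxl.
  - by move: y Gjy; exact/subsetPset/ndG/leq_maxr.
move=> k; have [? ?] := Foo k; have [? ?] := Goo k; split.
  by rewrite -[X in measurable X]setTI; apply: mg => //; exact: measurableX.
rewrite /lebesgue_cons /mpushforward /pushforward.
rewrite (_ : _ @^-1` _ = F k `*` G k); last first.
  by apply/funext => x; rewrite /preimage /mkset gK.
rewrite [X in (X < _)%E]product_measure1E//.
by rewrite lte_mul_pinfty// ge0_fin_numE.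
Qed.

HB.instance Definition _ :=
  Measure_isSigmaFinite.Build _ _ _ lebesgue_cons sigma_finite_lebesgue_cons.
End lebesgue_step.

Fixpoint lebesgueR (R : realType) (n : nat) :
    {sigma_finite_measure set (tupleR R n) -> \bar R} :=
  if n is m.+1 then lebesgue_cons (lebesgueR R m)
  else \d_([tuple] : tupleR R 0).

Definition RP_display : measure_display.
Proof. exact: default_measure_display. Qed.

(* A point of RP^n is a line through the origin of R^(n+1). *)
Record RP (R : realType) (n : nat) := ProjLine {
  line :> {vspace 'rV[R]_n.+1};
  _ : \dim line == 1%N }.

HB.instance Definition _ (R : realType) n := [isSub for @line R n].
HB.instance Definition _ (R : realType) n := [Choice of RP R n by <:].

Section projective_space.
Context {R : realType} {n : nat}.

Lemma dim_line0 : \dim <[delta_mx ord0 ord0 : 'rV[R]_n.+1]>%VS == 1%N.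
Proof.
rewrite dim_vline; suff -> : (delta_mx ord0 ord0 : 'rV[R]_n.+1) != 0 by [].
by apply/eqP => /matrixP /(_ ord0 ord0) /eqP; rewrite !mxE !eqxx oner_eq0.
Qed.

HB.instance Definition _ := isPointed.Build (RP R n) (ProjLine dim_line0).

(* [v]; the value at [v = 0] is irrelevant. *)
Definition direction (v : 'rV[R]_n.+1) : RP R n := insubd (point : RP R n) <[v]>%VS.

Definition tuple_direction (t : tupleR R n.+1) : RP R n :=
  direction (\row_i tnth t i).

Definition RP_measurable : set (set (RP R n)) :=
  image_set_system setT tuple_direction measurable.

Let RP_sigma_algebra : sigma_algebra setT RP_measurable.
Proof. exact/sigma_algebra_image/sigma_algebra_measurable. Qed.

Let RP_measurable0 : RP_measurable set0.
Proof. by have [] := RP_sigma_algebra. Qed.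

Let RP_measurableC A : RP_measurable A -> RP_measurable (~` A).
Proof. by have [_ + _] := RP_sigma_algebra => /[apply]; rewrite setTD. Qed.

Let RP_measurable_bigcup (A : (set (RP R n))^nat) :
  (forall i, RP_measurable (A i)) -> RP_measurable (\bigcup_i A i).
Proof. by have [_ _] := RP_sigma_algebra; exact. Qed.

(* The Borel sigma-algebra of RP^n, as the quotient of that of R^(n+1) \ {0}
   (adding the point 0 with any value does not change it, as {0} is Borel). *)
HB.instance Definition _ := @isMeasurable.Build RP_display (RP R n)
  RP_measurable RP_measurable0 RP_measurableC RP_measurable_bigcup.

Lemma measurable_tuple_direction : measurable_fun setT tuple_direction.
Proof. by []. Qed.

HB.instance Definition _ := isMeasurableFun.Build _ _ _ _
  tuple_direction measurable_tuple_direction.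

(* The affine chart attached to the n-plane of R^(n+1) through [b_0] with
   directions [b_1], ..., [b_n]. When [b] is a basis, this n-plane does not
   contain the origin, and every such n-plane is of this form. *)
Definition affine_chart (b : n.+1.-tuple 'rV[R]_n.+1) (x : tupleR R n) :
    RP R n :=
  direction (tnth b ord0 + \sum_(i < n) tnth x i *: tnth b (lift ord0 i)).

Lemma measurable_affine_chart b : measurable_fun setT (affine_chart b).
Proof.
pose h (x : tupleR R n) : tupleR R n.+1 :=
  [tuple tnth b ord0 ord0 j +
    \sum_(i < n) tnth x i * tnth b (lift ord0 i) ord0 j | j < n.+1].
have -> : affine_chart b = tuple_direction \o h.
  apply/funext => x; rewrite /affine_chart /tuple_direction /=.
  congr direction; apply/rowP => j; rewrite !mxE summxE tnth_mktuple.
  by congr (_ + _); apply: eq_bigr => i _; rewrite !mxE.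
apply: measurableT_comp; first exact: measurable_tuple_direction.
apply/measurable_fun_tnthP => j.
rewrite (_ : _ \o _ = fun x : tupleR R n => tnth b ord0 ord0 j +
    \sum_(i < n) tnth x i * tnth b (lift ord0 i) ord0 j); last first.
  by apply/funext => x /=; rewrite tnth_mktuple.
apply: measurable_funD; first exact: measurable_cst.
apply: measurable_sum => i.
apply: measurable_funM; last exact: measurable_cst.
exact: measurable_tnth.
Qed.

HB.instance Definition _ b := isMeasurableFun.Build _ _ _ _
  (affine_chart b) (measurable_affine_chart b).

(* The measure induced on RP^n by Lebesgue measure on an affine n-plane; the
   choice of the frame [b] of that n-plane only rescales it. *)
Definition affine_measure (b : n.+1.-tuple 'rV[R]_n.+1) :
    {measure set (RP R n) -> \bar R} :=
  mpushforward (lebesgueR R n) (affine_chart b).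

Definition unit_ball : set (tupleR R n.+1) :=
  [set t | \sum_i tnth t i ^+ 2 <= 1].

Lemma measurable_unit_ball : measurable unit_ball.
Proof.
rewrite (_ : unit_ball = setT `&` (fun t : tupleR R n.+1 =>
    \sum_(i < n.+1) tnth t i ^+ 2) @^-1` `]-oo, 1]); last first.
  by rewrite setTI; apply/seteqP; split => t /=; rewrite in_itv.
have: measurable_fun setT (fun t : tupleR R n.+1 =>
    \sum_(i < n.+1) tnth t i ^+ 2 : measurableTypeR R).
  apply: measurable_sum => i; apply: measurable_funX.
  exact: measurable_tnth.
by apply.
Qed.

(* The measure induced on RP^n by the canonical measure sigma of the sphere
   S^n, given in polar coordinates by
   sigma(A) = (n + 1) * Leb {r u | 0 <= r <= 1, u \in A}. *)
Definition sphere_measure : {measure set (RP R n) -> \bar R} :=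
  mscale (n.+1%:R)%:nng
    (mpushforward (mrestr (lebesgueR R n.+1) measurable_unit_ball)
      tuple_direction).

Definition simplex (E : n.+1.-tuple 'rV[R]_n.+1) : set (RP R n) :=
  [set direction (\sum_i t i *: tnth E i) | t in
    [set t : 'I_n.+1 -> R | (forall i, 0 <= t i) /\ exists i, t i != 0]].

Definition refine (E : n.+1.-tuple 'rV[R]_n.+1) (j : 'I_n.+1) :
    n.+1.-tuple 'rV[R]_n.+1 :=
  [tuple if i == j then tnth E j else tnth E i + tnth E j | i < n.+1].

(* The leftmost index of [I] acts first. *)
Definition refines (E : n.+1.-tuple 'rV[R]_n.+1) (I : seq 'I_n.+1) :
    n.+1.-tuple 'rV[R]_n.+1 :=
  foldl refine E I.

Definition gasket_step (E : n.+1.-tuple 'rV[R]_n.+1) (k : nat) :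
    set (RP R n) :=
  \bigcup_(I in [set I : seq 'I_n.+1 | size I = k]) simplex (refines E I).

Definition gasket (E : n.+1.-tuple 'rV[R]_n.+1) : set (RP R n) :=
  \bigcap_k gasket_step E k.

End projective_space.

(* Main.v *)
From HB Require Import structures.
Require Import Defs.
From mathcomp Require Import all_boot all_order all_algebra.
From mathcomp Require Import all_classical all_reals all_analysis.
From mathcomp Require Import measurable_realfun.
From mathcomp Require Import ring lra.

(** Fix a linear form equal to 1 on the vectors of E. A cone of step k whose
    generators take the values w_i on that form meets the slab {|form| <= m} in
    a set of volume at most 2 |det E| m^(n+1) / (w_0 ... w_n), and refining at j
    replaces w_i by w_i + w_j for all i <> j. So it suffices that the sum of
    1 / (w_0 ... w_n) over the words of length k tends to 0 from w = (1,...,1).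

    The ratio kept at each step, sum_j prod_(i <> j) w_i / (w_i + w_j), is < 1,
    but it tends to 1 when one weight m is much smaller than the largest one M.
    The inequalities w_l <= w_i + w_j (i, j, l distinct) hold for (1,...,1) and
    are preserved by refinement, so at most one weight can be small; then the
    loss is at least m / (4 M), whereas the expected growth of M / m in one
    step is O(m / M). Hence K + M / m is a strict Lyapunov function for K large
    enough, and it is unbounded exactly where there is no uniform loss. *)

Set Implicit Arguments.
Unset Strict Implicit.
Unset Printing Implicit Defensive.
Import Order.TTheory GRing.Theory Num.Theory.
Import numFieldNormedType.Exports.
Local Open Scope classical_set_scope.
Local Open Scope ring_scope.

(** * Weights *)

Section weights.
Variables (R : realFieldType) (I : finType).
Implicit Types (w : I -> R) (i j : I) (k : nat).

Definition child w j : I -> R := fun i => if i == j then w j else w i + w j.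

(* Up to a constant factor, the volume of the part of height at most 1 of a cone
   whose generators have heights [w]. *)
Definition wvol w : R := \prod_i (w i)^-1.

Fixpoint wmass k w : R :=
  if k is k'.+1 then \sum_j wmass k' (child w j) else wvol w.

Definition child_ratio w j : R := \prod_(i | i != j) (w i / (w i + w j)).

Lemma child_gt0 w j : (forall i, 0 < w i) -> forall i, 0 < child w j i.
Proof. by move=> w0 i; rewrite /child; case: eqP => // _; rewrite addr_gt0. Qed.

Lemma wvol_gt0 w : (forall i, 0 < w i) -> 0 < wvol w.
Proof. by move=> w0; apply: prodr_gt0 => i _; rewrite invr_gt0. Qed.

Lemma wvol_child w j : (forall i, 0 < w i) ->
  wvol (child w j) = child_ratio w j * wvol w.
Proof.
move=> w0; rewrite /wvol (bigD1 j) //= [in RHS](bigD1 j) //= /child eqxx.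
rewrite mulrCA; congr (_ * _); rewrite -big_split /=.
apply: eq_bigr => i /negbTE ->; rewrite mulrAC mulfV ?mul1r //.
by rewrite gt_eqF.
Qed.

Lemma prod_add1_ge (P : pred I) (x : I -> R) : (forall i, 0 <= x i) ->
  1 + \sum_(i | P i) x i <= \prod_(i | P i) (1 + x i).
Proof.
move=> x0; suff: 0 <= \sum_(i | P i) x i /\
   1 + \sum_(i | P i) x i <= \prod_(i | P i) (1 + x i) by case.
elim/big_rec2: _ => [|i z y _ [z0 zy]]; first by rewrite addr0.
have xi0 := x0 i; have xz0 := mulr_ge0 xi0 z0; split; first lra.
apply: (@le_trans _ _ ((1 + x i) * (1 + z))); last by rewrite ler_pM2l //; lra.
have -> : (1 + x i) * (1 + z) = 1 + (x i + z) + x i * z by ring.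
by rewrite lerDl.
Qed.

(* With [a i = (w i)^-1], the j-th product is [\prod_i (1 + a i / a j)^-1], which
   is at most [a j / \sum_i a i]. *)
Lemma sum_child_ratio_le1_in w (P : pred I) : (forall i, 0 < w i) ->
  \sum_(j | P j) \prod_(i | P i && (i != j)) (w i / (w i + w j)) <= 1.
Proof.
move=> w0; have [j0 Pj0|noP] := pickP P; last by rewrite big_pred0.
set s := \sum_(i | P i) (w i)^-1.
have s0 : 0 < s.
  rewrite /s (bigD1 j0) //= ltr_pwDl ?invr_gt0 // sumr_ge0 // => i _.
  by rewrite invr_ge0 ltW.
have s1 : \sum_(j | P j) (w j)^-1 / s = 1 by rewrite -mulr_suml mulfV // gt_eqF.
rewrite -[leRHS]s1; apply: ler_sum => j Pj.
have wj : (w j)^-1 / s = (1 + \sum_(i | P i && (i != j)) w j / w i)^-1.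
  rewrite -invfM; congr (_^-1); rewrite /s (bigD1 j) //= mulrDr.
  by rewrite mulfV ?gt_eqF // mulr_sumr.
have x0 i : 0 <= w j / w i by rewrite divr_ge0 ?ltW.
have := prod_add1_ge (fun i => P i && (i != j)) x0.
have -> : \prod_(i | P i && (i != j)) (w i / (w i + w j)) =
    (\prod_(i | P i && (i != j)) (w i / (w i + w j))^-1)^-1.
  by rewrite prodfV invrK.
rewrite wj => le_sp.
rewrite lef_pV2 ?posrE.
- apply: le_trans le_sp _; apply: ler_prod => i _.
  rewrite addr_ge0 //= invf_div; have := w0 i; have := w0 j => wj0 wi0.
  by rewrite mulrDl mulfV ?gt_eqF.
- by apply: prodr_gt0 => i _; rewrite invf_div divr_gt0 ?addr_gt0.
- by rewrite ltr_pwDl // sumr_ge0.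
Qed.

Lemma child_ratio_ge0 w j : (forall i, 0 < w i) -> 0 <= child_ratio w j.
Proof. by move=> w0; apply: prodr_ge0 => i _; rewrite divr_ge0 ?addr_ge0 ?ltW. Qed.

Lemma sum_child_ratio_le1 w : (forall i, 0 < w i) -> \sum_j child_ratio w j <= 1.
Proof. exact: (sum_child_ratio_le1_in xpredT). Qed.

(** The kept ratios sum to at most 1, so refining never increases the mass. This crude bound serves
    where the Lyapunov function is large. *)
Lemma wmass_le_wvol k w : (forall i, 0 < w i) -> wmass k w <= wvol w.
Proof.
elim: k w => [|k IH] w w0 //=.
apply: (@le_trans _ _ (\sum_j child_ratio w j * wvol w)).
  by apply: ler_sum => j _; rewrite -wvol_child //; apply/IH/child_gt0.
rewrite -mulr_suml; apply: ler_piMl; last exact: sum_child_ratio_le1.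
exact/ltW/wvol_gt0.
Qed.

Let frac_itv w i j : (forall i, 0 < w i) -> 0 <= w i / (w i + w j) <= 1.
Proof.
move=> w0; have := w0 i; have := w0 j => wj0 wi0.
rewrite ler_pdivrMr ?addr_gt0 // mul1r lerDl (ltW wj0) andbT.
by rewrite divr_ge0 ?addr_ge0 // ltW.
Qed.

Let compl_frac w i j : (forall i, 0 < w i) ->
  1 - w i / (w i + w j) = w j / (w j + w i).
Proof.
move=> w0; have wij : w i + w j != 0 by rewrite gt_eqF // addr_gt0.
by rewrite (addrC (w j)); field.
Qed.

Let frac_lower w i j M : (forall i, 0 < w i) -> (forall i, w i <= M) ->
  w i / (2 * M) <= w i / (w i + w j).
Proof.
move=> w0 wM; have := w0 i; have := w0 j; have := wM i; have := wM j.
move=> *; rewrite ler_pM2l // lef_pV2 ?posrE; lra.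
Qed.

Let exists_neq i0 : (1 < #|I|)%N -> exists i, i != i0.
Proof.
move=> I2; apply/existsP; rewrite -negb_forall; apply/negP => /forallP all0.
have: (#|I| <= #|pred1 i0|)%N
    by apply: subset_leq_card; apply/fintype.subsetP => i _; exact: all0.
by rewrite card1 leqNgt I2.
Qed.

(* With [x i = w i / (w i + w i0)] and [i2] the index of the second smallest
   weight, the terms [j != i0] add up to at most [1 - x i2], and the term [i0] is
   at most [x i2 * x i3] for any other [i3]. *)
Lemma sum_child_ratio_lt1 w i0 M : (2 < #|I|)%N -> (forall i, 0 < w i) ->
  (forall i, w i0 <= w i) -> (forall i, w i <= M) ->
  \sum_j child_ratio w j <= 1 - w i0 / (4 * M).
Proof.
move=> I3 w0 wm wM.
have [i1 i10] := exists_neq i0 (ltnW I3).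
have [i2 i20 i2min] : exists2 i2, i2 != i0 & forall i, i != i0 -> w i2 <= w i.
  have [i2 i20 i2min] := @Order.TotalTheory.arg_minP _ _ _ i1 (fun i => i != i0) w i10.
  by exists i2.
have [i3 /norP[i30 i32]] : exists i, ~~ ((i == i0) || (i == i2)).
  apply/existsP; rewrite -negb_forall; apply/negP => /forallP all0.
  have: (#|I| <= #|pred2 i0 i2|)%N
    by apply: subset_leq_card; apply/fintype.subsetP => i _; exact: all0.
  by rewrite leqNgt (leq_ltn_trans _ I3) // card2; case: eqP.
pose x i := w i / (w i + w i0).
have M0 : 0 < M by apply: lt_le_trans (w0 i0) (wM i0).
have k0 : child_ratio w i0 <= x i2 * x i3.
  rewrite /child_ratio (bigD1 i2) //= (bigD1 i3) /=; last by rewrite i30.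
  have /andP[a2 b2] := frac_itv i2 i0 w0; have /andP[a3 b3] := frac_itv i3 i0 w0.
  apply: ler_pM => //.
    by apply: mulr_ge0 => //; apply: prodr_ge0 => i _; case/andP: (frac_itv i i0 w0).
  by apply: ler_piMr => //; apply: prodr_ile1 => i _; exact: frac_itv.
(* Factoring out [i = i0] leaves products over the indices other than [i0], whose sum is at most 1
   by the bound relative to a predicate. The extracted factor is [1 - x j], largest at [j = i2]. *)
have kj : \sum_(j | j != i0) child_ratio w j <= 1 - x i2.
  apply: (@le_trans _ _ (\sum_(j | j != i0) (1 - x i2) *
      \prod_(i | (i != i0) && (i != j)) (w i / (w i + w j)))).
    apply: ler_sum => j j0; rewrite /child_ratio (bigD1 i0) 1?eq_sym //=.
    under [X in _ * X <= _]eq_bigl do rewrite andbC.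
    apply: ler_wpM2r.
      by apply: prodr_ge0 => i _; case/andP: (frac_itv i j w0).
    rewrite /x compl_frac // ler_pM2l // lef_pV2 ?posrE ?addr_gt0 // lerD2l.
    exact: i2min.
  rewrite -mulr_sumr; apply: ler_piMr; last exact: (sum_child_ratio_le1_in (fun j => j != i0)).
  by rewrite subr_ge0; case/andP: (frac_itv i2 i0 w0).
(* The two bounds add up to [1 - x i2 * (1 - x i3)], where [x i2 >= 1 / 2] because [w i0] is
   minimal. *)
rewrite (bigD1 i0) //=; apply: le_trans (lerD k0 kj) _.
have x2 : 1 / 2 <= x i2.
  by rewrite /x ler_pdivlMr ?addr_gt0 //; have := wm i2; lra.
have x3 : w i0 / (2 * M) <= 1 - x i3 by rewrite /x compl_frac // frac_lower.
have -> : w i0 / (4 * M) = 1 / 2 * (w i0 / (2 * M)) by field; rewrite gt_eqF.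
have : 1 / 2 * (w i0 / (2 * M)) <= x i2 * (1 - x i3).
  by apply: ler_pM => //; rewrite ?divr_ge0 ?mulr_ge0 ?ltW //; lra.
by rewrite mulrBr mulr1; lra.
Qed.

(* At most one weight can be much smaller than the others. *)
Definition triangular w :=
  forall i j l, i != j -> i != l -> j != l -> w l <= w i + w j.

(** If [i] or [j] is [j0], the new inequality reduces to the old one. If [l] is [j0], positivity
    suffices. Otherwise the right side gains [2 * w j0] and the left side only [w j0]. *)
Lemma triangular_child w j0 : (forall i, 0 < w i) -> triangular w ->
  triangular (child w j0).
Proof.
move=> w0 tw i j l ij il jl; rewrite /child.
have := tw i j l ij il jl; have := w0 i; have := w0 j; have := w0 j0; have := w0 l.
case: (i =P j0) ij il => [->|_] ij il; case: (j =P j0) ij jl => [->|_] ij jl;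
  case: (l =P j0) il jl => [->|_] il jl; rewrite ?eqxx in ij il jl *; try lra.
Qed.

(** Chosen so that the loss [K * m / (4 * M)] equals [(3 * #|I| + 1) * m / M]: this pays a cost of
    [3 * m / M] for each index and leaves a gain of [m / M]. *)
Let K : R := 4 * (3 * #|I|%:R + 1).

(** The factor after [child_ratio w j] bounds the Lyapunov function of the [j]-th child, whose
    weights lie between [w j] and [w l + w j]. For [j != i0] the quotient is at most 3, since
    [w l <= w i0 + w j <= 2 * w j]. *)
Lemma lyapunov_drift w i0 l : (2 < #|I|)%N -> (forall i, 0 < w i) ->
  triangular w -> (forall i, w i0 <= w i) -> (forall i, w i <= w l) ->
  \sum_j child_ratio w j * (K + (if j == i0 then (w l + w i0) / w i0 else 3)) <=
  K + w l / w i0 - w i0 / w l.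
Proof.
move=> I3 w0 tw wm wM; set m := w i0; set M := w l.
have m0 : 0 < m := w0 i0; have M0 : 0 < M := w0 l.
have K0 : 0 < K by rewrite /K mulr_gt0 // ltr_wpDl // mulr_ge0.
under eq_bigr do rewrite mulrDr; rewrite big_split /= -mulr_suml.
have s1 := sum_child_ratio_lt1 I3 w0 wm wM.
have s2 : (\sum_j child_ratio w j) * K <= (1 - m / (4 * M)) * K by rewrite ler_pM2r.
have -> : K + M / m - m / M =
    (1 - m / (4 * M)) * K + (M / m + 3 * #|I|%:R * (m / M)).
  by rewrite /K; field; rewrite !gt_eqF.
apply: lerD => //; rewrite (bigD1 i0) //= eqxx; apply: lerD.
  have kM : child_ratio w i0 <= M / (M + m).
    have [i1 i10 wi1] : exists2 i1, i1 != i0 & w i1 = M.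
      (* When [l = i0] all weights coincide, so any other index serves. *)
      have [l0|l0] := eqVneq l i0; last by exists l.
      have [i1 i10] := exists_neq i0 (ltnW I3); exists i1 => //.
      by apply/eqP; rewrite eq_le wM /M l0 wm.
    rewrite /child_ratio (bigD1 i1) //= wi1; apply: ler_piMr.
      by rewrite divr_ge0 ?addr_ge0 ?ltW.
    by apply: prodr_ile1 => i _; exact: frac_itv.
  apply: (@le_trans _ _ (M / (M + m) * ((M + m) / m))).
    by rewrite ler_wpM2r // divr_ge0 ?addr_ge0 ?ltW.
  by rewrite mulrA mulfVK // gt_eqF // addr_gt0.
(* Triangularity gives [M <= m + w j], so each child other than [i0] keeps at most the fraction
   [m / M]. *)
apply: (@le_trans _ _ (\sum_(j | j != i0) 3 * (m / M))).
  apply: ler_sum => j j0; rewrite (negbTE j0) mulrC ler_pM2l //.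
  rewrite /child_ratio (bigD1 i0) 1?eq_sym //=.
  have Mjm : M <= m + w j.
    have [l0|l0] := eqVneq l i0; first by rewrite /M l0 lerDl ltW.
    have [lj|lj] := eqVneq l j; first by rewrite /M lj lerDr ltW.
    by apply: tw; rewrite // eq_sym.
  apply: (@le_trans _ _ (m / (m + w j))).
    apply: ler_piMr; first by case/andP: (frac_itv i0 j w0).
    by apply: prodr_ile1 => i _; exact: frac_itv.
  by rewrite ler_pM2l // lef_pV2 ?posrE // addr_gt0.
rewrite -mulr_suml sumr_const -[_ *+ #|_|]mulr_natr.
apply: ler_wpM2r; first by rewrite divr_ge0 ?ltW.
by rewrite ler_pM2l // ler_nat max_card.
Qed.

(** The bounds [m] and [M] are free, so that the induction hypothesis applies to a child with [w j]
    and [w l + w j]. The summand [e] absorbs the weights of Lyapunov value at least [e^-1]; below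
    that value each letter costs a factor [1 - e ^+ 2]. *)
Lemma wmass_bound (e : R) k w (m M : R) : (2 < #|I|)%N -> 0 < e < 1 -> 0 < m ->
  triangular w -> (forall i, m <= w i <= M) ->
  wmass k w <= (e + (1 - e ^+ 2) ^+ k) * wvol w * (K + M / m).
Proof.
move=> I3 /andP[e0 e1]; have K0 : 1 <= K.
  have : 0 <= #|I|%:R :> R by []. by rewrite /K; lra.
have /card_gt0P[i1 _] : (0 < #|I|)%N by apply: leq_trans I3.
have q0 : 0 <= 1 - e ^+ 2 by rewrite subr_ge0 expr_le1 // ltW.
elim: k w m M => [|k IH] w m M m0 tw wmM.
  have w0 i : 0 < w i by case/andP: (wmM i) => /(lt_le_trans m0).
  have M0 : 0 <= M by case/andP: (wmM i1) => a b; exact: le_trans (ltW m0) (le_trans a b).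
  rewrite expr0 mulrAC; apply: ler_peMl; first exact/ltW/wvol_gt0.
  have : 0 <= M / m by rewrite divr_ge0 // ltW.
  by move=> Mm; apply: (@le_trans _ _ (1 * 1)); [rewrite mulr1|apply: ler_pM => //; lra].
have w0 i : 0 < w i by case/andP: (wmM i) => /(lt_le_trans m0).
have [i0 _ i0min] := @Order.TotalTheory.arg_minP _ _ _ i1 xpredT w isT.
have [l _ lmax] := @Order.TotalTheory.arg_maxP _ _ _ i1 xpredT w isT.
have {}i0min i : w i0 <= w i by exact: i0min.
have {}lmax i : w i <= w l by exact: lmax.
set b := fun k => e + (1 - e ^+ 2) ^+ k.
have b0 r : 0 < b r by rewrite ltr_pwDl // exprn_ge0.
pose h := K + w l / w i0.
have hpos : 0 < h by rewrite /h ltr_pwDl ?divr_ge0 ?ltW // (lt_le_trans _ K0).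
(* The bound grows when the interval from [m] to [M] is widened, so it is enough to treat the
   extreme weights. *)
suff: wmass k.+1 w <= b k.+1 * wvol w * h.
  move/le_trans; apply; rewrite ler_pM2l ?mulr_gt0 ?wvol_gt0 // lerD2l.
  have /andP[? _] := wmM i0; have /andP[_ ?] := wmM l.
  by apply: ler_pM; rewrite ?invr_ge0 ?lef_pV2 ?posrE // ltW.
(* Either the bound follows from [wmass k.+1 w <= wvol w], or [h] is bounded and
   the drift gives a uniform factor. *)
have [he|he] := leP e^-1 h.
  apply: le_trans (wmass_le_wvol _ w0) _; rewrite mulrAC.
  apply: ler_peMl; first exact/ltW/wvol_gt0.
  apply: (@le_trans _ _ (e * e^-1)); first by rewrite mulfV // gt_eqF.
  apply: ler_pM => //; rewrite ?invr_ge0; try exact: ltW.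
  by rewrite /b lerDl exprn_ge0.
apply: (@le_trans _ _ (\sum_j b k * wvol w *
    (child_ratio w j * (K + (if j == i0 then (w l + w i0) / w i0 else 3))))).
  apply: ler_sum => j _.
  have wj0 := w0 j.
  have mj i : w j <= child w j i <= w l + w j.
    rewrite /child; case: eqP => [_|_]; first by rewrite lexx lerDr ltW.
    by rewrite lerDr lerD2r ltW //=.
  have := IH (child w j) (w j) (w l + w j) (w0 j) (triangular_child j w0 tw) mj.
  move/le_trans; apply; rewrite wvol_child // -/(b k).
  rewrite [b k * (_ * _)]mulrCA [in leRHS]mulrCA -!mulrA.
  do 3![apply: ler_wpM2l; first by rewrite ?child_ratio_ge0 // ltW ?wvol_gt0].
  rewrite lerD2l.
  have [->//|j0] := eqVneq j i0.
  rewrite ler_pdivrMr //; have := i0min j; have := w0 j.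
  suff : w l <= w i0 + w j by lra.
  have [->|l0] := eqVneq l i0; first by rewrite lerDl ltW.
  by have [->|lj] := eqVneq l j; [rewrite lerDr ltW | apply: tw; rewrite // eq_sym].
rewrite -mulr_sumr.
apply: (@le_trans _ _ (b k * wvol w * (h - w i0 / w l))).
  by rewrite ler_pM2l ?mulr_gt0 ?wvol_gt0 //; exact: lyapunov_drift.
apply: (@le_trans _ _ (b k * wvol w * ((1 - e ^+ 2) * h))).
  rewrite ler_pM2l ?mulr_gt0 ?wvol_gt0 //.
  (* Both halves come from [h < e^-1]: it gives [e ^+ 2 * h <= e], and with [w l / w i0 <= h] it
     gives [e <= w i0 / w l]. *)
  suff : e ^+ 2 * h <= w i0 / w l by lra.
  apply: (@le_trans _ _ e).
    rewrite expr2 -mulrA; apply: ler_piMr; first exact: ltW.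
    by rewrite -ler_pdivlMl // mulr1 ltW.
  rewrite -[X in X <= _]invrK -[X in _ <= X]invrK lef_pV2 ?posrE ?invr_gt0 ?divr_gt0 //.
  by rewrite invf_div; apply: le_trans (ltW he); rewrite lerDr; exact: le_trans K0.
rewrite !mulrA ler_pM2r // mulrAC ler_pM2r ?wvol_gt0 //.
(* Only the geometric summand has to shrink; for the constant one [e * (1 - e ^+ 2) <= e] is
   enough. *)
rewrite /b [_ ^+ k.+1]exprSr [leLHS]mulrDl lerD2r.
by apply: ler_piMr; rewrite ?gerBl ?exprn_ge0 // ltW.
Qed.
End weights.

(** * Linear changes of variables *)

Section lebesgue.
Context {R : realType}.
Notation lambda := (@lebesgue_measure R).

Lemma measurable_preimageT d1 d2 (T1 : measurableType d1) (T2 : measurableType d2)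
    (f : T1 -> T2) (S : set T2) :
  measurable_fun setT f -> measurable S -> measurable (f @^-1` S).
Proof. by move=> mf mS; rewrite -[X in measurable X]setTI; exact: mf. Qed.

(** The pushforward of [lambda] under the map, multiplied by the absolute value of [a], agrees with
    [lambda] on the intervals []l, r]], and these determine the measure. *)
Lemma lebesgue_measure_affine (a c : R) (S : set (measurableTypeR R)) :
  a != 0 -> measurable S ->
  lambda ((fun x => a * x + c) @^-1` S) = (`|a|^-1%:E * lambda S)%E.
Proof.
move=> a0 mS.
have mf : measurable_fun setT (fun x : measurableTypeR R => a * x + c : measurableTypeR R).
  apply: measurable_funD => //; exact: measurable_funM.
pose f : {mfun measurableTypeR R >-> measurableTypeR R} :=
  HB.pack (fun x : measurableTypeR R => a * x + c : measurableTypeR R)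
    (isMeasurableFun.Build _ _ _ _ _ mf).
have a_ge0 : 0 <= `|a| by [].
pose mu := mscale (NngNum a_ge0) (mpushforward lambda f).
have := @lebesgue_measure_unique R mu _ _ mS => ->; last first.
  move=> _ [[l r] _ <-] /=.
  rewrite /mu /mscale /= /mpushforward /pushforward /=.
  rewrite lebesgue_measure_itv /=.
  have [a_gt0|a_lt0|a_eq0] := ltgtP 0 a; last by rewrite -a_eq0 eqxx in a0.
    rewrite (_ : _ @^-1` _ = `](l - c) / a, (r - c) / a]%classic); last first.
      apply/seteqP; split=> x /=; rewrite !in_itv /= ltr_pdivrMr // ler_pdivlMr //;
        by rewrite ltrBlDr lerBrDr mulrC.
    rewrite lebesgue_measure_itv /= !lte_fin ltr_pM2r ?invr_gt0 // ltrD2r.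
    case: ifP => _; rewrite ?mule0 // -!EFinB -EFinM gtr0_norm //.
    by congr (_%:E); field.
  (* A negative slope exchanges the endpoints, so the preimage of []l, r]] is closed on the left and
     open on the right. *)
  rewrite (_ : _ @^-1` _ = `[(r - c) / a, (l - c) / a[%classic); last first.
    apply/seteqP; split=> x /=; rewrite !in_itv /= ler_ndivrMr // ltr_ndivlMr //;
      by rewrite ltrBlDr lerBrDr mulrC andbC.
  rewrite lebesgue_measure_itv /= !lte_fin ltr_nM2r ?invr_lt0 // ltrD2r.
  case: ifP => _; rewrite ?mule0 // -!EFinB -EFinM ltr0_norm //.
  by congr (_%:E); field.
rewrite /mu /mscale /= /mpushforward /pushforward /= muleA -EFinM mulVf ?mul1e //.
by rewrite normr_eq0.
Qed.

Lemma lebesgueR_S n (S : set (tupleR R n.+1)) :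
  lebesgueR R n.+1 S = (\int[lambda]_x lebesgueR R n [set t | S (cons_tupleR (x, t))])%E.
Proof.
rewrite [LHS]/=; rewrite /lebesgue_cons /mpushforward /pushforward /product_measure1.
apply: eq_integral => x _ /=; congr (lebesgueR R n _).
by apply/seteqP; split=> t; rewrite /xsection /= inE.
Qed.

(** By Tonelli; this order of integration suits maps that move only the first coordinate. *)
Lemma lebesgueR_Sr n (S : set (tupleR R n.+1)) : measurable S ->
  lebesgueR R n.+1 S = (\int[lebesgueR R n]_t lambda [set x | S (cons_tupleR (x, t))])%E.
Proof.
move=> mS; pose S' := @cons_tupleR R n @^-1` S.
have mS' : measurable S' by apply: measurable_preimageT => //; exact: measurable_cons_tupleR.
have := @indic_fubini_tonelli _ _ _ _ R lambda (lebesgueR R n) S' mS'.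
rewrite indic_fubini_tonelli_FE // indic_fubini_tonelli_GE // => h.
rewrite [LHS]h.
apply: eq_integral => t _ /=; congr (lambda _).
by apply/seteqP; split=> x; rewrite /ysection /= inE.
Qed.

Definition row_of n (t : tupleR R n) : 'rV[R]_n := \row_i tnth t i.

Definition affine_map n (A : 'M[R]_n) (c : 'rV[R]_n) (t : tupleR R n) :
  tupleR R n := [tuple (row_of t *m A + c) ord0 j | j < n].

Lemma row_of_inj n : injective (@row_of n).
Proof.
by move=> s t /rowP st; apply: eq_from_tnth => i; have := st i; rewrite !mxE.
Qed.

Lemma row_of_affine n A c (t : tupleR R n) :
  row_of (affine_map A c t) = row_of t *m A + c.
Proof. by apply/rowP => i; rewrite [LHS]mxE tnth_mktuple. Qed.

Lemma row_of_cons n x (t : tupleR R n) :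
  row_of (cons_tupleR (x, t)) = row_mx x%:M (row_of t) :> 'rV[R]_(1 + n).
Proof.
apply/rowP => i; rewrite [LHS]mxE; case: (split_ordP i) => j ->.
  by rewrite row_mxEl ord1 mxE eqxx mulr1n.
rewrite row_mxEr mxE (_ : rshift 1 j = lift ord0 j) ?tnthS //.
exact/val_inj.
Qed.

Lemma affine_map_comp n A B c d (t : tupleR R n) :
  affine_map B d (affine_map A c t) = affine_map (A *m B) (c *m B + d) t.
Proof.
by apply: row_of_inj; rewrite !row_of_affine mulmxDl addrA mulmxA.
Qed.

Lemma measurable_affine_map n A c :
  measurable_fun setT (@affine_map n A c).
Proof.
apply/measurable_fun_tnthP => j.
rewrite (_ : _ \o _ = fun t : tupleR R n =>
    \sum_(i < n) tnth t i * A i j + c ord0 j); last first.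
  apply/funext => t /=; rewrite tnth_mktuple !mxE; congr (_ + _).
  by apply: eq_bigr => i _; rewrite mxE.
apply: measurable_funD; last exact: measurable_cst.
apply: measurable_sum => i; apply: measurable_funM; last exact: measurable_cst.
exact: measurable_tnth.
Qed.

Let measurable_section n x (S : set (tupleR R n.+1)) :
  measurable S -> measurable [set t | S (cons_tupleR (x, t))].
Proof.
move=> mS; apply: (@measurable_preimageT _ _ _ _ (fun t => cons_tupleR (x, t))) => //.
apply: measurableT_comp; first exact: measurable_cons_tupleR.
exact: measurable_pair1.
Qed.

Let measurable_sectionr n t (S : set (tupleR R n.+1)) :
  measurable S -> measurable [set x | S (cons_tupleR (x, t))].
Proof.
move=> mS; apply: (@measurable_preimageT _ _ _ _ (fun x => cons_tupleR (x, t))) => //.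
apply: measurableT_comp; first exact: measurable_cons_tupleR.
exact: measurable_pair2.
Qed.

Lemma measurable_lebesgue_section n (S : set (tupleR R n.+1)) : measurable S ->
  measurable_fun setT (fun x => lebesgueR R n [set t | S (cons_tupleR (x, t))]).
Proof.
move=> mS; have mS' := measurable_preimageT (@measurable_cons_tupleR R n) mS.
have := measurable_fun_xsection (lebesgueR R n) mS'.
apply: eq_measurable_fun => x _ /=; congr (lebesgueR R n _).
by apply/seteqP; split=> t; rewrite /xsection /= inE.
Qed.

Let measurable_lebesgue_sectionr n (S : set (tupleR R n.+1)) : measurable S ->
  measurable_fun setT (fun t => lambda [set x | S (cons_tupleR (x, t))]).
Proof.
move=> mS; have mS' := measurable_preimageT (@measurable_cons_tupleR R n) mS.
have := measurable_fun_ysection lambda mS'.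
apply: eq_measurable_fun => t _ /=; congr (lambda _).
by apply/seteqP; split=> x; rewrite /ysection /= inE.
Qed.

Lemma preimage_eq1 (T U : Type) (f g : T -> U) (S : set U) : f =1 g ->
  f @^-1` S = g @^-1` S.
Proof. by move=> fg; apply/seteqP; split=> t; rewrite /preimage /mkset fg. Qed.

Let scales n (A : 'M[R]_n) := forall c (S : set (tupleR R n)), measurable S ->
  lebesgueR R n (affine_map A c @^-1` S) = (`|\det A|^-1%:E * lebesgueR R n S)%E.

(** Acting on row vectors, the map fixes the first coordinate [x] and acts on the slice at [x] by
    [B] followed by the translation by [x *: u + c]. Slicing thus reduces the claim to
    [scales B]. *)
Let scales_ublock n (u : 'rV[R]_n) (B : 'M[R]_n) (c : 'rV[R]_n) : scales B ->
  forall S : set (tupleR R n.+1), measurable S ->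
  lebesgueR R n.+1 (affine_map (block_mx 1%:M u 0 B : 'M[R]_(1 + n)) (row_mx 0 c)
    @^-1` S) =
   (`|\det B|^-1%:E * lebesgueR R n.+1 S)%E.
Proof.
move=> sB S mS; rewrite !lebesgueR_S -ge0_integralZl //; last
  exact: measurable_lebesgue_section.
apply: eq_integral => x _; rewrite -(sB (x *: u + c)); last exact: measurable_section.
congr (lebesgueR R n _).
have E t : affine_map (block_mx 1%:M u 0 B : 'M[R]_(1 + n)) (row_mx 0 c)
    (cons_tupleR (x, t)) = cons_tupleR (x, affine_map B (x *: u + c) t).
  apply: row_of_inj; rewrite row_of_affine !row_of_cons.
  rewrite mul_row_block mulmx1 mulmx0 addr0 mul_scalar_mx add_row_mx addr0.
  by rewrite row_of_affine addrA (addrC (x *: u)).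
exact: (preimage_eq1 S E).
Qed.

(** The map fixes every coordinate but the first, on which it is affine of slope [a]; slicing the
    other way reduces the claim to the real line. *)
Let scales_lblock n (a c0 : R) (l : 'cV[R]_n) : a != 0 ->
  forall S : set (tupleR R n.+1), measurable S ->
  lebesgueR R n.+1 (affine_map (block_mx a%:M 0 l 1%:M : 'M[R]_(1 + n))
    (row_mx c0%:M 0) @^-1` S) =
   (`|a|^-1%:E * lebesgueR R n.+1 S)%E.
Proof.
move=> a0 S mS; rewrite !lebesgueR_Sr //; last first.
  exact: (measurable_preimageT (measurable_affine_map _ _) mS).
rewrite -ge0_integralZl //; last exact: measurable_lebesgue_sectionr.
apply: eq_integral => t _.
rewrite -(lebesgue_measure_affine ((row_of t *m l) 0 0 + c0) a0); last first.
  exact: measurable_sectionr.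
congr (lambda _).
have E x : affine_map (block_mx a%:M 0 l 1%:M : 'M[R]_(1 + n)) (row_mx c0%:M 0)
    (cons_tupleR (x, t)) = cons_tupleR (a * x + ((row_of t *m l) 0 0 + c0), t).
  apply: row_of_inj; rewrite row_of_affine !row_of_cons.
  rewrite mul_row_block mulmx1 mulmx0 add0r add_row_mx addr0 -scalar_mxM.
  by rewrite [in LHS](mx11_scalar (row_of t *m l)) -!raddfD /= addrA (mulrC x).
exact: (preimage_eq1 S E).
Qed.

(** Induction on [n] by elimination. With a nonzero pivot the matrix is a product [L *m U] whose
    factors are handled by slices; a zero pivot is first repaired by a shear. The determinant
    appears inverted because a preimage is measured. *)
Lemma lebesgueR_affine n (A : 'M[R]_n) (c : 'rV[R]_n) (S : set (tupleR R n)) :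
  \det A != 0 -> measurable S ->
  lebesgueR R n (affine_map A c @^-1` S) = (`|\det A|^-1%:E * lebesgueR R n S)%E.
Proof.
elim: n A c S => [|n IH] A c S detA mS.
  have E : affine_map A c =1 id by move=> t; rewrite (tuple0 (affine_map _ _ _))
    (tuple0 t).
  by rewrite (preimage_eq1 S E) preimage_id det_mx00 normr1 invr1 mul1e.
have pivot (A' : 'M[R]_(1 + n)) c' : \det A' != 0 -> A' 0 0 != 0 ->
    lebesgueR R n.+1 (affine_map A' c' @^-1` S) =
      (`|\det A'|^-1%:E * lebesgueR R n.+1 S)%E.
  set a := A' 0 0 => detA' a0.
  (* Gaussian elimination of the first row and column. *)
  pose u := a^-1 *: ursubmx A'; pose l := dlsubmx A'.
  pose B := drsubmx A' - l *m u; pose c0 := c' 0 0.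
  pose L : 'M[R]_(1 + n) := block_mx a%:M 0 l 1%:M.
  pose U : 'M[R]_(1 + n) := block_mx 1%:M u 0 B.
  have A'E : A' = L *m U.
    rewrite mulmx_block !mulmx0 !mul0mx !mulmx1 !mul1mx !addr0.
    rewrite mul_scalar_mx scalerA mulfV // scale1r addrC subrK.
    rewrite -[LHS]submxK; congr block_mx.
    rewrite [ulsubmx A']mx11_scalar; congr _%:M; rewrite !mxE /a.
    by congr (A' _ _); apply/val_inj.
  have detE : \det A' = a * \det B.
    rewrite A'E det_mulmx det_lblock det_ublock !det1 mul1r mulr1.
    by rewrite det_scalar1.
  have detB : \det B != 0.
    by move: detA'; rewrite detE mulf_eq0 negb_or => /andP[].
  have E : affine_map A' c' =1
      affine_map U (row_mx 0 (rsubmx (c' : 'rV_(1 + n)) - c0 *: u)) \o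
      affine_map L (row_mx c0%:M 0).
    move=> t; rewrite [RHS]/= affine_map_comp -A'E; congr affine_map.
    rewrite mul_row_block mulmx1 mulmx0 mul0mx !addr0 add_row_mx addr0.
    rewrite mul_scalar_mx addrC subrK -[LHS](@hsubmxK _ 1 1 n); congr row_mx.
    rewrite [LHS]mx11_scalar; congr _%:M; rewrite mxE /c0.
    by congr (c' _ _); apply/val_inj.
  rewrite (preimage_eq1 S E) comp_preimage scales_lblock //; last first.
    exact: (measurable_preimageT (measurable_affine_map _ _) mS).
  rewrite scales_ublock //; last by move=> *; exact: IH.
  by rewrite muleA -EFinM -invfM -normrM detE.
have [A00|A00] := eqVneq (A 0 0) 0; last exact: pivot.
have [i Ai0] : exists i : 'I_n, (A : 'M[R]_(1 + n)) (rshift 1 i) 0 != 0.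
  apply/existsP; rewrite -negb_forall; apply: contraNN detA => /forallP Ai0.
  rewrite (expand_det_col _ 0) big1 // => i _.
  suff -> : A i 0 = 0 by rewrite mul0r.
  have := split_ordP (i : 'I_(1 + n)) => -[j ->|j ->]; last exact/eqP.
  by rewrite -A00; congr (A _ _); apply/val_inj; rewrite /= ord1.
(* Left multiplication by [T 1] adds to the first row a lower row whose first entry is nonzero,
   which creates a pivot; [T (-1)] undoes it. *)
pose T (s : R) : 'M[R]_(1 + n) := block_mx 1%:M (s *: delta_mx 0 i) 0 1%:M.
have TT : T (-1) *m T 1 = 1%:M.
  rewrite mulmx_block !mulmx0 !mul0mx !mulmx1 !mul1mx !addr0 add0r.
  by rewrite scaleN1r scale1r subrr -scalar_mx_block.
have detT s : \det (T s) = 1 by rewrite det_ublock !det1 mulr1.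
have TA0 : (T 1 *m (A : 'M[R]_(1 + n))) 0 0 != 0.
  have z0 : 0 = lshift n 0 :> 'I_(1 + n) by exact/val_inj.
  move: A00 Ai0; rewrite z0 mxE big_split_ord big_ord1 => A00 Ai0.
  rewrite (bigD1 i) //= big1 => [|j ji].
    by rewrite A00 mulr0 add0r addr0 block_mxEur !mxE !eqxx !mul1r.
  by rewrite block_mxEur !mxE (negbTE ji) mulr0 mul0r.
have E : affine_map A c =1
    affine_map (T 1 *m A) c \o affine_map (T (- 1)) (row_mx 0 0).
  move=> t; rewrite [RHS]/= affine_map_comp mulmxA TT mul1mx.
  by rewrite row_mx0 mul0mx add0r.
rewrite (preimage_eq1 S E) comp_preimage scales_ublock; last first.
- exact: (measurable_preimageT (measurable_affine_map _ _) mS).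
- by move=> d S' mS'; rewrite IH // det1 ?oner_eq0.
rewrite det1 normr1 invr1 mul1e pivot // ?det_mulmx ?detT ?mul1r //.
Qed.
End lebesgue.

(** * Volume of the gasket *)

Lemma measure_bigcup_fin_le d (T : measurableType d) (R : realType)
    (mu : {measure set T -> \bar R}) (I : finType) (F : I -> set T) :
  (forall i, measurable (F i)) ->
  (mu (\bigcup_i F i) <= \sum_i mu (F i))%E.
Proof.
move=> mF; rewrite (_ : \bigcup_i F i = \big[setU/set0]_i F i); last first.
  by rewrite -bigcup_pred; apply/seteqP; split=> x [i _ Fix]; exists i.
suff [] : measurable (\big[setU/set0]_i F i) /\
   (mu (\big[setU/set0]_i F i) <= \sum_i mu (F i))%E by [].
elim/big_rec2: _ => [|i y X _ [mX muX]]; first by rewrite measure0.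
split; first exact: measurableU.
by apply: (le_trans (measureU2 _ _ _)) => //; exact: leeD2l.
Qed.

Section gasket.
Context {R : realType}.

Lemma measurable_tnth_itv n (i : 'I_n) (J : interval R) :
  measurable [set t : tupleR R n | tnth t i \in J].
Proof.
apply: (@measurable_preimageT _ _ _ _ (fun t : tupleR R n => tnth t i) [set` J]).
  exact: measurable_tnth.
exact: measurable_itv.
Qed.

Lemma measurable_forall_tnth n (J : 'I_n -> interval R) :
  measurable [set t : tupleR R n | forall i, tnth t i \in J i].
Proof.
rewrite (_ : mkset _ = \bigcap_i [set t : tupleR R n | tnth t i \in J i]); last first.
  by apply/seteqP; split=> t /=; [move=> tJ i _; exact: tJ|move=> tJ i; exact: tJ].
apply: fin_bigcap_measurable => // i _; exact: measurable_tnth_itv.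
Qed.

Definition box n (r : 'I_n -> R) : set (tupleR R n) :=
  [set t | forall i, tnth t i \in `[0, r i]].

Lemma lebesgueR_box n (r : 'I_n -> R) : (forall i, 0 <= r i) ->
  lebesgueR R n (box r) = (\prod_i r i)%:E.
Proof.
elim: n r => [|n IH] r r0.
  by rewrite big_ord0 /= diracE mem_set // => -[].
rewrite [LHS]/= /lebesgue_cons /mpushforward /pushforward.
rewrite (_ : _ @^-1` _ =
    `[0, r ord0]%classic `*` box (fun i => r (lift ord0 i))); last first.
  apply/seteqP; split=> -[x t] /=.
    move=> xt; split; first by have := xt ord0; rewrite tnth0.
    by move=> i; have := xt (lift ord0 i); rewrite tnthS.
  move=> [x0 tr] i; case: (unliftP ord0 i) => [j ->|->]; last by rewrite tnth0.
  by rewrite tnthS; exact: tr.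
rewrite [LHS]product_measure1E; first last.
- exact: measurable_forall_tnth.
- exact: measurable_itv.
rewrite IH // big_ord_recl EFinM; congr (_ * _)%E.
rewrite [LHS]lebesgue_measure_itv /= lte_fin; case: ifPn => [_|].
  by rewrite -EFinB subr0.
by rewrite -leNgt => r00; congr (_%:E); apply/le_anti; rewrite r0 r00.
Qed.

(** * Frames, and measurability of the simplices *)

Definition frame n (E : n.+1.-tuple 'rV[R]_n.+1) : 'M[R]_n.+1 :=
  \matrix_i tnth E i.

Lemma sum_frame n (E : n.+1.-tuple 'rV[R]_n.+1) (s : 'rV_n.+1) :
  \sum_i s ord0 i *: tnth E i = s *m frame E.
Proof.
apply/rowP => j; rewrite summxE mxE; apply: eq_bigr => i _.
by rewrite !mxE.
Qed.

Lemma det_frame_neq0 n (E : n.+1.-tuple 'rV[R]_n.+1) :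
  basis_of fullv E -> \det (frame E) != 0.
Proof.
move=> /basis_free/freeP freeE; apply/det0P => -[v v0 vE].
case/negP: v0; apply/eqP/rowP => i; rewrite mxE; apply: freeE.
by rewrite -[RHS]vE -sum_frame; apply: eq_bigr => j _; rewrite (tnth_nth 0).
Qed.

(** Refining is left multiplication by [B]. Row [j] of [B] is a unit vector, and deleting row and
    column [j] leaves the identity, so [B] has determinant 1. *)
Lemma det_frame_refine n (E : n.+1.-tuple 'rV[R]_n.+1) j :
  \det (frame (refine E j)) = \det (frame E).
Proof.
pose B : 'M[R]_n.+1 := \matrix_(i, k) ((i == k)%:R + ((k == j) && (i != j))%:R).
have -> : frame (refine E j) = B *m frame E.
  apply/row_matrixP => i; rewrite rowK row_mul -sum_frame tnth_mktuple.
  case: (eqVneq i j) => [->|ij].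
    rewrite (bigD1 j) //= big1 => [|k kj]; rewrite !mxE eqxx /=.
      by rewrite !addr0 scale1r.
    by rewrite andbF addr0 eq_sym (negbTE kj) scale0r.
  rewrite (bigD1 i) //= (bigD1 j) 1?eq_sym //= big1 => [|k /andP[ki kj]].
    by rewrite !mxE !eqxx (negbTE ij) /= add0r !addr0 !scale1r.
  by rewrite !mxE (eq_sym i k) (negbTE ki) (negbTE kj) addr0 scale0r.
rewrite det_mulmx (_ : \det B = 1) ?mul1r // (expand_det_row _ j) (bigD1 j) //=.
rewrite big1 => [|k kj]; last first.
  by rewrite mxE eqxx /= andbF addr0 eq_sym (negbTE kj) mul0r.
rewrite addr0 mxE !eqxx /= addr0 mul1r /cofactor -signr_odd addnn odd_double mul1r.
rewrite (_ : row' j (col' j B) = 1%:M) ?det1 //; apply/matrixP => i k.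
by rewrite !mxE (inj_eq lift_inj) [lift j k == j]eq_sym (negbTE (neq_lift _ _)) addr0.
Qed.

Lemma direction_eq n (v w : 'rV[R]_n.+1) : v != 0 -> w != 0 ->
  direction v = direction w <-> exists2 k, k != 0 & v = k *: w.
Proof.
have val_direction (u : 'rV[R]_n.+1) : u != 0 -> val (direction u) = <[u]>%VS.
  by move=> u0; rewrite /direction val_insubd dim_vline u0.
move=> v0 w0; split=> [vw|[k k0 ->]].
  have /vlineP[k vE] : v \in <[w]>%VS.
    by rewrite -val_direction // -vw val_direction // memv_line.
  by exists k => //; apply: contraNneq v0 => k0; rewrite vE k0 scale0r.
apply: val_inj; rewrite !val_direction ?scaler_eq0 ?negb_or ?k0 //.
apply/eqP; rewrite eqEsubv; apply/andP; split; apply/vlineP.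
  by exists k.
by exists k^-1; rewrite scalerA mulVf // scale1r.
Qed.

(** A direction determines a vector only up to a nonzero factor of either sign, hence two opposite
    cones. *)
Lemma simplexP n (E : n.+1.-tuple 'rV[R]_n.+1) (v : 'rV[R]_n.+1) :
  \det (frame E) != 0 -> v != 0 ->
  simplex E (direction v) <->
  (forall i, 0 <= (v *m invmx (frame E)) ord0 i) \/
  (forall i, 0 <= (v *m - invmx (frame E)) ord0 i).
Proof.
move=> detE v0; have uE : frame E \in unitmx by rewrite unitmxE unitfE.
split=> [[s [s0 [i si]]]|].
  pose sr : 'rV[R]_n.+1 := \row_i s i.
  rewrite (eq_bigr (fun i => sr ord0 i *: tnth E i)) => [|j _]; last by rewrite mxE.
  rewrite sum_frame => dsv.
  have sE0 : sr *m frame E != 0.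
    apply: contraNneq si => /(congr1 (fun x => x *m invmx (frame E))).
    by rewrite mulmxK // mul0mx => /rowP /(_ i); rewrite !mxE => ->.
  have [k k0 ->] := (direction_eq v0 sE0).1 (esym dsv).
  have [kp|kn] := leP 0 k; [left|right] => j.
    by rewrite -scalemxAl mulmxK // !mxE mulr_ge0.
  by rewrite mulmxN -scalemxAl mulmxK // !mxE -mulNr mulr_ge0 // oppr_ge0 ltW.
have key (s : 'rV[R]_n.+1) (k : R) : k != 0 -> v = k *: (s *m frame E) ->
    (forall i, 0 <= s ord0 i) -> simplex E (direction v).
  move=> k0 vE s0; have s_neq0 : s != 0.
    by apply: contraNneq v0 => s0'; rewrite vE s0' mul0mx scaler0.
  exists (s ord0).
    split=> //; have [i si] := rV0Pn _ s_neq0; by exists i.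
  rewrite sum_frame; apply/esym/direction_eq => //; last by exists k.
  by apply: contraNneq v0 => sE; rewrite vE sE scaler0.
case=> [|]; [apply: (key _ 1)|apply: (key _ (-1))]; rewrite ?oner_eq0 ?oppr_eq0 ?oner_eq0 //.
  by rewrite scale1r mulmxKV.
by rewrite mulmxN mulNmx mulmxKV // scaleN1r opprK.
Qed.

Lemma measurable_RP n (S : set (RP R n)) :
  measurable (@tuple_direction R n @^-1` S) -> measurable S.
Proof.
by move=> mS; rewrite -[measurable S]/(measurable
  (setT `&` @tuple_direction R n @^-1` S)) setTI.
Qed.

(** Away from the origin the preimage among vectors is the union [U] of two opposite closed cones.
    At the origin [direction] takes a default value, which may or may not lie in the simplex; hence
    the two cases, with and without the point [Z]. *)
Lemma measurable_simplex n (E : n.+1.-tuple 'rV[R]_n.+1) :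
  \det (frame E) != 0 -> measurable (simplex E).
Proof.
move=> detE.
pose C A : set (tupleR R n.+1) :=
  affine_map A 0 @^-1` [set t | forall i, tnth t i \in `[0, +oo[ ].
have CP A t : C A t <-> forall i, 0 <= (row_of t *m A) ord0 i.
  by split=> + i => /(_ i); rewrite /= tnth_mktuple addr0 in_itv /= andbT.
have mC A : measurable (C A).
  apply: measurable_preimageT; first exact: measurable_affine_map.
  exact: measurable_forall_tnth.
pose U := C (invmx (frame E)) `|` C (- invmx (frame E)).
have mU : measurable U by exact: measurableU.
pose Z : set (tupleR R n.+1) := [set t | forall i, tnth t i \in `[0, 0] ].
have mZ : measurable Z by exact: measurable_forall_tnth.
have ZP t : Z t <-> row_of t = 0.
  split=> [Zt|/rowP t0 i]; last first.
    by have := t0 i; rewrite !mxE => ->; rewrite in_itv /= lexx.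
  apply/rowP => i; rewrite !mxE; apply/le_anti.
  by have := Zt i; rewrite in_itv /= andbC.
have UP t : row_of t != 0 -> simplex E (tuple_direction t) <-> U t.
  by move=> t0; rewrite simplexP // /U /setU /mkset !CP.
have D0 t : row_of t = 0 -> tuple_direction t = direction 0.
  by rewrite /tuple_direction -/(row_of t) => ->.
apply: measurable_RP.
have [E0|E0] := pselect (simplex E (direction 0)).
  rewrite (_ : _ @^-1` _ = U) //; apply/seteqP; split => t;
    have [t0|t0] := eqVneq (row_of t) 0.
  - by move=> _; left; apply/CP => i; rewrite t0 mul0mx mxE.
  - by move/(UP _ t0).
  - by rewrite /preimage /mkset D0.
  - by move/(UP _ t0).
rewrite (_ : _ @^-1` _ = U `\` Z); first exact: measurableD.
apply/seteqP; split => t; have [t0|t0] := eqVneq (row_of t) 0.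
- by rewrite /preimage /mkset D0.
- by move=> /(UP _ t0) Ut; split => // /ZP/eqP; apply/negP.
- by move=> [_ /(_ ((ZP _).2 t0))].
- by move=> [/(UP _ t0)].
Qed.


Lemma gasket_step0 n (E : n.+1.-tuple 'rV[R]_n.+1) : gasket_step E 0 = simplex E.
Proof.
by apply/seteqP; split=> [x [I /= /size0nil -> //]|x Ex]; exists [::].
Qed.

Lemma gasket_stepS n (E : n.+1.-tuple 'rV[R]_n.+1) k :
  gasket_step E k.+1 = \bigcup_j gasket_step (refine E j) k.
Proof.
apply/seteqP; split=> [x [[//|j I] /= [kI] Ix]|x [j _ [I /= kI Ix]]].
  by exists j => //; exists I.
by exists (j :: I) => //=; rewrite kI.
Qed.

Lemma measurable_gasket_step n (E : n.+1.-tuple 'rV[R]_n.+1) k :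
  \det (frame E) != 0 -> measurable (gasket_step E k).
Proof.
elim: k E => [|k IH] E detE; first by rewrite gasket_step0; exact: measurable_simplex.
rewrite gasket_stepS; apply: fin_bigcup_measurable => // j _.
by apply: IH; rewrite det_frame_refine.
Qed.

Lemma measurable_gasket n (E : n.+1.-tuple 'rV[R]_n.+1) :
  \det (frame E) != 0 -> measurable (gasket E).
Proof.
by move=> detE; apply: bigcapT_measurable => k; exact: measurable_gasket_step.
Qed.

(** * Volumes of cones cut off by a slab *)

Definition slab n (p : 'cV[R]_n) (m : R) : set (tupleR R n) :=
  [set t | `|(row_of t *m p) ord0 ord0| <= m].

Lemma measurable_slab n (p : 'cV[R]_n) m : measurable (slab p m).
Proof.
have mp : measurable_fun setT
    (fun t : tupleR R n => (row_of t *m p) ord0 ord0 : measurableTypeR R).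
  rewrite (_ : (fun t => _) = fun t : tupleR R n => \sum_(i < n) tnth t i * p i ord0).
    apply: measurable_sum => i; apply: measurable_funM; last exact: measurable_cst.
    exact: measurable_tnth.
  by apply/funext => t; rewrite mxE; apply: eq_bigr => i _; rewrite mxE.
rewrite (_ : slab p m =
    (fun t : tupleR R n => (row_of t *m p) ord0 ord0) @^-1` `[- m, m]%classic).
  by apply: (measurable_preimageT mp); exact: measurable_itv.
by apply/seteqP; split=> t; rewrite /slab /preimage /mkset /= in_itv /= ler_norml.
Qed.

(** In the coordinates of [E] the form [p] has coefficients [w], so nonnegative coordinates [x] of a
    point of the slab satisfy [x i * w i <= m] and lie in a box. Using the box for the corner
    simplex loses only a factor depending on [n]; the leading 2 counts the two opposite cones. *)
Lemma simplex_slab_le n (E : n.+1.-tuple 'rV[R]_n.+1) (p : 'cV[R]_n.+1)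
    (w : 'I_n.+1 -> R) (m : R) :
  \det (frame E) != 0 -> 0 <= m -> (forall i, 0 < w i) ->
  (forall i, (tnth E i *m p) ord0 ord0 = w i) ->
  (lebesgueR R n.+1 (@tuple_direction R n @^-1` simplex E `&` slab p m) <=
    (2 * (`|\det (frame E)| * m ^+ n.+1) * wvol w)%:E)%E.
Proof.
move=> detE m0 w0 Ep; have uE : frame E \in unitmx by rewrite unitmxE unitfE.
set M := frame E in detE uE *.
pose B A := affine_map A 0 @^-1` box (fun i => m / w i) : set (tupleR R n.+1).
have mbox : measurable (box (fun i => m / w i)) by exact: measurable_forall_tnth.
have mB A : measurable (B A) by exact: (measurable_preimageT (measurable_affine_map _ _)).
have muB A : `|\det A| = `|\det M|^-1 ->
    lebesgueR R n.+1 (B A) = (`|\det M| * m ^+ n.+1 * wvol w)%:E.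
  move=> detA; rewrite lebesgueR_affine //; last first.
    by rewrite -normr_eq0 detA invr_eq0 normr_eq0.
  rewrite detA invrK lebesgueR_box => [|i]; last by rewrite divr_ge0 // ltW.
  by rewrite big_split /= prodr_const card_ord -mulrA EFinM.
have detV : `|\det (invmx M)| = `|\det M|^-1 by rewrite det_inv normfV.
have detNV : `|\det (- invmx M)| = `|\det M|^-1.
  by rewrite -scaleN1r detZ normrM normrX normrN1 expr1n mul1r.
have inB A t : (forall i, 0 <= (row_of t *m A) ord0 i) ->
    `|(row_of t *m A *m M *m p) ord0 ord0| <= m -> B A t.
  set x := row_of t *m A => x0 xm i.
  have -> : tnth (affine_map A 0 t) i = x ord0 i by rewrite tnth_mktuple addr0.
  rewrite in_itv /= x0 /= ler_pdivlMr //; apply: le_trans xm.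
  rewrite -sum_frame mulmx_suml summxE.
  have xw j : (x ord0 j *: tnth E j *m p) ord0 ord0 = x ord0 j * w j.
    by rewrite -scalemxAl [LHS]mxE Ep.
  apply: le_trans (ler_norm _); rewrite (bigD1 i) //= xw lerDl.
  by apply: sumr_ge0 => j _; rewrite xw mulr_ge0 // ltW.
apply: (@le_trans _ _ (lebesgueR R n.+1 (B (invmx M) `|` B (- invmx M)))).
  apply: le_measure; rewrite ?inE.
  - apply: measurableI; last exact: measurable_slab.
    apply: measurable_preimageT; first exact: measurable_tuple_direction.
    exact: measurable_simplex.
  - exact: measurableU.
  move=> t [tE tm]; have [t0|t0] := eqVneq (row_of t) 0.
    left; apply: inB; first by move=> i; rewrite t0 mul0mx mxE.
    by rewrite t0 !mul0mx mxE normr0.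
  case: ((simplexP detE t0).1 tE) => s0; [left|right]; apply: inB => //.
    by rewrite mulmxKV.
  by rewrite mulmxN !mulNmx mulmxKV // mxE normrN.
apply: (le_trans (measureU2 _ (mB _) (mB _))).
rewrite [X in (X + _)%E]muB // [X in (_ + X)%E]muB //.
by rewrite -EFinD lee_fin -!mulrA mulr_natl mulr2n.
Qed.

(** The form [p] stays fixed while the basis is refined: the determinant does not change and the
    values of [p] on the basis evolve by [child], so the bounds add up to [wmass]. *)
Lemma gasket_step_slab_le n k (E : n.+1.-tuple 'rV[R]_n.+1) (p : 'cV[R]_n.+1)
    (w : 'I_n.+1 -> R) (m : R) :
  \det (frame E) != 0 -> 0 <= m -> (forall i, 0 < w i) ->
  (forall i, (tnth E i *m p) ord0 ord0 = w i) ->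
  (lebesgueR R n.+1 (@tuple_direction R n @^-1` gasket_step E k `&` slab p m) <=
    (2 * (`|\det (frame E)| * m ^+ n.+1) * wmass k w)%:E)%E.
Proof.
elim: k E w => [|k IH] E w detE m0 w0 Ep.
  by rewrite gasket_step0; exact: simplex_slab_le.
rewrite gasket_stepS preimage_bigcup setI_bigcupl.
apply: le_trans (measure_bigcup_fin_le _ _) _.
  move=> j; apply: measurableI; last exact: measurable_slab.
  apply: measurable_preimageT; first exact: measurable_tuple_direction.
  by apply: measurable_gasket_step; rewrite det_frame_refine.
rewrite /= mulr_sumr -sumEFin; apply: lee_sum => j _.
rewrite -(det_frame_refine E j); apply: IH => //.
- by rewrite det_frame_refine.
- exact: child_gt0.
- move=> i; rewrite tnth_mktuple /child; case: eqP => // _.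
  by rewrite mulmxDl mxE !Ep.
Qed.

End gasket.

(** * Vanishing of the measures *)

Lemma wmass_ones_small (R : realType) (I : finType) (c : R) :
  (2 < #|I|)%N -> 0 < c -> exists k, wmass k (fun _ : I => 1) <= c.
Proof.
(* This is the last factor of [wmass_bound] at [m = M = 1], hence the final [+ 1]. *)
move=> I3 c0; pose K : R := 4 * (3 * #|I|%:R + 1) + 1.
have K1 : 1 <= K by rewrite /K; have : 0 <= #|I|%:R :> R by []; lra.
(* The first entry ensures [e < 1]; the second gives [2 * e * K <= c], where [2 * e] will bound
   [e + (1 - e ^+ 2) ^+ k]. *)
pose e := Num.min (1 / 2) (c / (2 * K)).
have e0 : 0 < e by rewrite lt_min !divr_gt0 //; lra.
have e1 : e < 1 by rewrite gt_min; apply/orP; left; lra.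
have ec : 2 * e * K <= c.
  have : e <= c / (2 * K) by rewrite ge_min lexx orbT.
  by rewrite ler_pdivlMr ?mulr_gt0 //; lra.
have e2 : 0 <= 1 - e ^+ 2 by rewrite subr_ge0 expr_le1 // ltW.
have [k qk] : exists k, (1 - e ^+ 2) ^+ k < e.
  have q1 : `|1 - e ^+ 2| < 1 by rewrite ger0_norm // ltrBlDr ltrDl exprn_gt0.
  have /cvgrPdist_lt/(_ _ e0)[k _ /(_ k (leqnn k))] := cvg_expr q1.
  rewrite /= sub0r normrN normrX ger0_norm // => qk; by exists k.
exists k; apply: le_trans ec.
have tw : triangular (fun _ : I => 1 : R) by move=> *; lra.
have e01 : 0 < e < 1 by rewrite e0.
have := @wmass_bound R I e k (fun _ => 1) 1 1 I3 e01 ltr01 tw (fun _ => _).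
rewrite lexx => /(_ (fun _ => isT))/le_trans; apply.
rewrite divr1 -/K /wvol big1 => [|i _]; last by rewrite invr1.
rewrite mulr1 ler_pM2r; last lra.
by lra.
Qed.

Section null.
Context {R : realType}.

Lemma gasket_slab_null n (E : n.+1.-tuple 'rV[R]_n.+1) (p : 'cV[R]_n.+1) (m : R) :
  (2 <= n)%N -> \det (frame E) != 0 -> 0 <= m ->
  (forall i, (tnth E i *m p) ord0 ord0 = 1) ->
  lebesgueR R n.+1 (@tuple_direction R n @^-1` gasket E `&` slab p m) = 0%E.
Proof.
move=> n2 detE m0 Ep; apply/eqP; rewrite eq_le measure_ge0 andbT.
apply/lee_addgt0Pr => e e0; rewrite add0e.
pose C : R := 2 * (`|\det (frame E)| * m ^+ n.+1).
have C0 : 0 <= C by rewrite /C !mulr_ge0 // exprn_ge0.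
(* The denominator is [C + 1] because [C] vanishes when [m = 0]. *)
have [k wk] : exists k, wmass k (fun _ : 'I_n.+1 => 1) <= e / (C + 1).
  by apply: wmass_ones_small; rewrite ?card_ord // divr_gt0 //; lra.
have := gasket_step_slab_le k detE m0 (fun _ => ltr01) Ep.
rewrite -/C => le_k; apply: (@le_trans _ _ (C * wmass k (fun _ : 'I_n.+1 => 1))%:E).
  apply: le_trans le_k; apply: le_measure; rewrite ?inE.
  - apply: measurableI; last exact: measurable_slab.
    apply: measurable_preimageT; first exact: measurable_tuple_direction.
    exact: measurable_gasket.
  - apply: measurableI; last exact: measurable_slab.
    apply: measurable_preimageT; first exact: measurable_tuple_direction.
    exact: measurable_gasket_step.
  by move=> t [tE tm]; split => //; exact: tE.
rewrite lee_fin; apply: (@le_trans _ _ (C * (e / (C + 1)))).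
  exact: ler_wpM2l.
rewrite mulrCA; apply: ler_piMr; first exact: ltW.
by rewrite ler_pdivrMr; lra.
Qed.

(** The slabs of integer height exhaust the space, so the cone over the gasket is a countable union
    of null sets. *)
Lemma lebesgueR_gasket n (E : n.+1.-tuple 'rV[R]_n.+1) :
  (2 <= n)%N -> \det (frame E) != 0 ->
  lebesgueR R n.+1 (@tuple_direction R n @^-1` gasket E) = 0%E.
Proof.
move=> n2 detE; have uE : frame E \in unitmx by rewrite unitmxE unitfE.
(* The linear form equal to 1 on every vector of [E]. *)
pose p : 'cV[R]_n.+1 := invmx (frame E) *m const_mx 1.
have Ep i : (tnth E i *m p) ord0 ord0 = 1.
  by rewrite -[tnth E i](rowK (tnth E)) -/(frame E) -row_mul mulKVmx // !mxE.
have mG : measurable (@tuple_direction R n @^-1` gasket E).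
  apply: measurable_preimageT; first exact: measurable_tuple_direction.
  exact: measurable_gasket.
rewrite (_ : _ @^-1` _ =
    \bigcup_m (@tuple_direction R n @^-1` gasket E `&` slab p m%:R)); last first.
  apply/seteqP; split=> [t tE|t [m _ []//]].
  exists (Num.bound `|(row_of t *m p) ord0 ord0|) => //; split=> //.
  by rewrite /slab /mkset ltW // archi_boundP.
have mGs m : measurable (@tuple_direction R n @^-1` gasket E `&` slab p m).
  by apply: measurableI => //; exact: measurable_slab.
apply/negligibleP; first by apply: bigcupT_measurable => m.
apply: negligible_bigcup => m; apply/negligibleP => //.
exact: gasket_slab_null.
Qed.

Lemma direction_scale n (k : R) (v : 'rV[R]_n.+1) : k != 0 ->
  direction (k *: v) = direction v.
Proof.
move=> k0; have [->|v0] := eqVneq v 0; first by rewrite scaler0.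
by apply/direction_eq; rewrite ?scaler_eq0 ?negb_or ?k0 //; exists k.
Qed.

(** An affine plane is itself null in the ambient space, so the chart is compared with a cone: [N]
    is the cone over the gasket in the coordinates of [b], null by the linear case, and a positive
    volume of [S] would give [N] positive volume. *)
Lemma affine_measure_gasket n (E b : n.+1.-tuple 'rV[R]_n.+1) :
  (2 <= n)%N -> \det (frame E) != 0 -> \det (frame b) != 0 ->
  affine_measure b (gasket E) = 0%E.
Proof.
move=> n2 detE detb; rewrite /affine_measure /= /mpushforward /pushforward.
set S := affine_chart b @^-1` gasket E.
have mG : measurable (@tuple_direction R n @^-1` gasket E).
  apply: measurable_preimageT; first exact: measurable_tuple_direction.
  exact: measurable_gasket.
have mS : measurable S.
  apply: measurable_preimageT; first exact: measurable_affine_chart.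
  exact: measurable_gasket.
pose N := affine_map (frame b) 0 @^-1` (@tuple_direction R n @^-1` gasket E).
have mN : measurable N by exact: (measurable_preimageT (measurable_affine_map _ _)).
have N0 : lebesgueR R n.+1 N = 0%E.
  by rewrite lebesgueR_affine // lebesgueR_gasket // mule0.
(* The vector with coordinates [(r, t)] in the frame [b] is [r] times the chart vector with
   parameters [t / r], so both have the same direction. *)
have sec r : r != 0 ->
    [set t | N (cons_tupleR (r, t))] = affine_map (r^-1%:M) 0 @^-1` S.
  move=> r0.
  have E1 t : tuple_direction (affine_map (frame b) 0 (cons_tupleR (r, t))) =
      affine_chart b (affine_map (r^-1%:M) 0 t).
    rewrite /tuple_direction -/(row_of _) row_of_affine addr0 -sum_frame.
    rewrite /affine_chart -[in RHS](direction_scale _ r0); congr direction.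
    rewrite big_ord_recl scalerDr mxE tnth0 scaler_sumr; congr (_ + _).
     apply: eq_bigr => i _; rewrite mxE tnthS tnth_mktuple addr0 scalerA; congr (_ *: _).
    by rewrite mul_mx_scalar !mxE mulVKf.
  by apply/seteqP; split=> t; rewrite /N /S /preimage /mkset E1.
(* The sections of the cone [N] at heights [r >= 1] are dilates of [S]. *)
suff SN : (lebesgueR R n S <= lebesgueR R n.+1 N)%E.
  by apply/eqP; rewrite eq_le measure_ge0 andbT -[leRHS]N0.
rewrite lebesgueR_S.
have mf := measurable_lebesgue_section mN.
(* An interval of length 1 on which the dilation factor [r ^+ n] is at least 1. *)
pose J : set (measurableTypeR R) := `[1%R, 2%R]%classic.
have mJ : measurable J by exact: measurable_itv.
have J1 : lebesgue_measure J = 1%E.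
  rewrite /J lebesgue_measure_itv /= lte_fin ltr1n -EFinB.
  by congr (_%:E); lra.
have le1 : (
    \int[lebesgue_measure]_(x in J) lebesgueR R n [set t | N (cons_tupleR (x, t))] <=
    \int[lebesgue_measure]_x lebesgueR R n [set t | N (cons_tupleR (x, t))])%E.
  exact: ge0_subset_integral.
apply: le_trans le1.
rewrite -[leLHS]mule1 -J1 -integral_cst //.
apply: ge0_le_integral => //.
  exact: measurable_funTS.
move=> r; rewrite /J /= in_itv /= => /andP[r1 _].
have r0 : 0 < r by lra.
rewrite sec ?gt_eqF // lebesgueR_affine //; last first.
  by rewrite det_scalar expf_neq0 // invr_eq0 gt_eqF.
apply: lee_pemull => //; rewrite lee_fin det_scalar.
rewrite normrX normfV exprVn invrK gtr0_norm //.
by rewrite exprn_ege1.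
Qed.
End null.

Theorem theorem1 (R : realType) (n : nat) (n_ge2 : (2 <= n)%N)
    (E : n.+1.-tuple 'rV[R]_n.+1) (E_basis : basis_of fullv E) :
  (forall b : n.+1.-tuple 'rV[R]_n.+1, basis_of fullv b ->
     affine_measure b (gasket E) = 0%E) /\
  sphere_measure (gasket E) = 0%E.
Proof.
have detE := det_frame_neq0 E_basis; split.
  by move=> b /det_frame_neq0; exact: affine_measure_gasket.
(* The sphere measure is a multiple of the volume of the part of the cone in the unit ball, which is
   a subset of a null set. *)
rewrite /sphere_measure /= /mscale /= /mpushforward /pushforward /= /mrestr.
have mG : measurable (@tuple_direction R n @^-1` gasket E).
  apply: measurable_preimageT; first exact: measurable_tuple_direction.
  exact: measurable_gasket.
rewrite [X in (_ * X)%E](_ : _ = 0%E) ?mule0 //.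
apply: (subset_measure0 _ mG) => //.
- by apply: measurableI => //; exact: measurable_unit_ball.
- exact: lebesgueR_gasket.
Qed.
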